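(* Let $(\tau(n))_{n\in\mathbb{N}}$ be a sequence of real numbers with $\lim_{n\to\infty}\tau(n)=\infty$, $\lim_{n\to\infty}\frac{\tau(n)}{n}=0$ and $\tau(n)\ge 1$ for all $n\in\mathbb{N}$. Let $(\Omega,\mathcal{C},P)$ be a probability space and let $\mu=u\circ P:\mathcal{C}\to[0,1]$, where $u:[0,1]\to\mathbb{R}$ is a strictly increasing and concave function with $u(0)=0$, $u(1)=1$ and $0<u'(0)<\infty$. Let $Y=\{Y_{n,k}=V_{n+1:k+1}:n\in\mathbb{N},\ k=0,1,\dots,n\}$ be the triangular array of uniform order statistics on $(\Omega,\mathcal{C},P)$. Then for any random function $f:[0,1]\times\Omega\to\mathbb{R}$ which is continuous at each $x\in[0,1]$ uniformly with respect to $\omega\in\Omega$, any $r\in(0,1)$ and any $n\in\mathbb{N}$, $$\mu\left(\left\{\omega\in\Omega:\sup_{x\in[0,1]}|B_{n}(f,Y)(x,\omega)-f(x,\omega)|>(1+c)K\left(f;\sqrt{\frac{\tau(n)}{n}}\right)\right\}\right)\le u'(0)\cdot\frac{n+1}{\sqrt{1-r}}\exp\left(-\frac{3r}{2}\tau(n)\right),$$ where $c=\frac{4306+837\sqrt{6}}{5832}$ is the Sikkema constant.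
   Context: $\mathbb{N}$ denotes the positive integers. Uniform order statistics: for each $n\in\mathbb{N}$, $(V_{j})_{j=1}^{n+1}$ is a finite sequence of independent identically distributed random variables (with respect to $P$) having the uniform distribution on $[0,1]$, and $V_{n+1:1}\le\dots\le V_{n+1:n+1}$ are the order statistics obtained by arranging $(V_{j})_{j=1}^{n+1}$ in increasing order. That $f$ is a random function means that $f(x,\cdot)$ is $\mathcal{C}$-measurable for each $x\in[0,1]$. ''Continuous at each $x\in[0,1]$ uniformly with respect to $\omega$'' means: for every $x\in[0,1]$ and $\varepsilon>0$ there is $\delta>0$ such that $|f(y,\omega)-f(x,\omega)|<\varepsilon$ for all $\omega\in\Omega$ and all $y\in[0,1]$ with $|y-x|<\delta$. The stochastic Bernstein polynomials are $B_{n}(f,Y)(x,\omega)=\sum_{k=0}^{n}f(Y_{n,k}(\omega),\omega)\,p_{k,n}(x)$ with $p_{k,n}(x)=\binom{n}{k}x^{k}(1-x)^{n-k}$. For $\delta\ge 0$, $K(f;\delta)=\sup_{\omega\in\Omega}\ \sup\{|f(x,\omega)-f(y,\omega)|:x,y\in[0,1],\ |x-y|\le\delta\}$. *)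

(* Defs.v *)
From mathcomp Require Export all_boot all_order all_algebra.
From mathcomp Require Export all_classical all_reals all_analysis.
Export Order.TTheory GRing.Theory Num.Theory.
Export numFieldNormedType.Exports.

Set Implicit Arguments.
Unset Strict Implicit.
Unset Printing Implicit Defensive.

Local Open Scope classical_set_scope.
Local Open Scope ring_scope.

Definition sikkema {R : realType} : R :=
  (4306%:R + 837%:R * Num.sqrt 6%:R) / 5832%:R.

Definition concave_on {R : realType} (D : set R) (u : R -> R) : Prop :=
  convex_function D (fun x => - u x : R^o).

(* One-sided difference quotient: only the values of u on [0, 1] matter. *)
Definition has_right_derivative {R : realType} (u : R -> R) (a l : R) : Prop :=
  h^-1 * (u (a + h) - u a) @[h --> 0^'+] --> l.

(* u o P; P is extended-real valued, but finite on measurable sets. *)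
Definition distorted {d : measure_display} {T : measurableType d}
    {R : realType} (u : R -> R) (P : probability T R) (A : set T) : R :=
  u (fine (P A)).

Section Independence.
Context {d : measure_display} {T : measurableType d} {R : realType}.
Variable P : probability T R.

Definition mutually_independent (I : finType) (X : I -> {RV P >-> R}) : Prop :=
  forall (J : {set I}) (B : I -> set R), (forall i, measurable (B i)) ->
    P (\bigcap_(i in [set i | i \in J]) (X i @^-1` B i)) =
    (\prod_(i in J) P (X i @^-1` B i))%E.

(* The two laws are compared on Borel sets only, since both sides are
   functions defined on arbitrary sets. *)
Definition uniform01 (X : {RV P >-> R}) : Prop :=
  forall B : set R, measurable B ->
    distribution P X B = uniform_prob (@ltr01 R) B.

End Independence.

Definition order_statistic {R : realType} (m : nat) (v : 'I_m -> R) (k : nat)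
  : R := nth 0 (sort <=%R [seq v j | j <- enum 'I_m]) k.

(* Y_{n,k} = V_{n+1:k+1}; the k-th entry, counted from 0, of the sorted
   sample of size n+1. *)
Definition uniform_array {T : Type} {R : realType}
    (V : forall n : nat, 'I_n.+1 -> T -> R) (n k : nat) (w : T) : R :=
  order_statistic (fun j => V n j w) k.

Definition bernstein {R : realType} (k n : nat) (x : R) : R :=
  'C(n, k)%:R * x ^+ k * (1 - x) ^+ (n - k).

Definition stochastic_bernstein {T : Type} {R : realType} (n : nat)
    (f : R -> T -> R) (Y : nat -> nat -> T -> R) (x : R) (w : T) : R :=
  \sum_(0 <= k < n.+1) f (Y n k w) w * bernstein k n x.

Definition random_function {d : measure_display} {T : measurableType d}
    {R : realType} (f : R -> T -> R) : Prop :=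
  forall x, x \in `[0, 1] -> measurable_fun [set: T] (f x).

Definition continuous_uniformly_in_omega {T : Type} {R : realType}
    (f : R -> T -> R) : Prop :=
  forall x, x \in `[0, 1] -> forall e : R, 0 < e ->
    exists2 delta : R, 0 < delta &
      forall (w : T) (y : R), y \in `[0, 1] -> `|y - x| < delta ->
        `|f y w - f x w| < e.

(* Suprema are taken in the extended reals. *)
Definition modulus {T : Type} {R : realType} (f : R -> T -> R) (delta : R)
  : \bar R :=
  ereal_sup [set ereal_sup [set (`|f xy.1 w - f xy.2 w|)%:E | xy in
      [set xy : R * R | [/\ xy.1 \in `[0, 1], xy.2 \in `[0, 1]
                          & `|xy.1 - xy.2| <= delta]]] | w in [set: T]].

Definition sup_error {T : Type} {R : realType} (n : nat)
    (f : R -> T -> R) (Y : nat -> nat -> T -> R) (w : T) : \bar R :=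
  ereal_sup [set (`|stochastic_bernstein n f Y x w - f x w|)%:E
            | x in [set x : R | x \in `[0, 1]]].

(* Main.v *)
Require Import Defs.
From mathcomp Require Import all_boot all_order all_algebra.
From mathcomp Require Import all_classical all_reals all_analysis.
From mathcomp Require Import measurable_realfun ring lra.

Set Implicit Arguments.
Unset Strict Implicit.
Unset Printing Implicit Defensive.

Local Open Scope classical_set_scope.
Local Open Scope ring_scope.

(** Write [delta = sqrt (tau n / n)], so that [n * delta ^+ 2 = tau n >= 1], and
let [K] be the modulus of continuity of [f] at [delta], a number which is the
same for all sample points. A deterministic estimate of the Bernstein error with
the extremal constant of Sikkema can be avoided: that constant would matter only
for small [n] or for small [tau n], and there the claim holds for simpler
reasons.

- If [n <= 4] then [2 * delta >= 1], so any two points of the unit interval are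
  at most two steps of length [delta] apart; the error is at most [2 * K], and the
  event is empty (lemma [bernstein_coarse_error]).

- If [n >= 5] and [tau n <= 2], the right-hand side is at least [u'(0)] (lemma
  [bound_ge1]), while the distorted probability is at most [u'(0)].

- If [n >= 5] and [tau n >= 2], the event forces some order statistic to lie
  farther than [delta] from its node [k / n]. Off that event, replacing the
  random nodes by the nodes [k / n] costs at most [K]; and the Bernstein operator
  with nodes [k / n] errs by at most [K * (1 + 2 * exp (- 2 * tau n))], because
  the binomial weights of the nodes far from [x] are exponentially small (lemma
  [bernstein_node_error]). Since [2 * exp (- 4) <= sikkema - 1], the total is
  at most [(1 + sikkema) * K].

The order statistics are controlled by counting: the [k]-th one, counted from
[0], exceeds [t] exactly when at most [k] of the [n + 1] variables are below or at [t]. The counts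
are binomial, and Hoeffding's inequality gives [exp (- 2 * (n + 1) * delta ^+ 2)]
for each of the two tails: the mismatch between the node [k / n] and the [n + 1]
sample points always goes in the favourable direction. The union bound over the
[2 * (n + 1)] tails yields [2 * (n + 1) * exp (- 2 * tau n)], which lies below
the required bound for every [r] (lemma [two_tails_le]). Finally a concave [u]
vanishing at [0] satisfies [u p <= u'(0) * p], and this transports the
estimate from [P] to the distorted measure.

Hoeffding's moment bound for a single trial (lemma [hoeffding_bernoulli]) is
thus used twice: for the binomial weights in the Bernstein operator and for the
counts of the sample. *)

(** * Hoeffding's moment bound *)

Lemma ge0_derive_ge_at0 (R : realType) (f df : R -> R) :
  (forall x : R, is_derive x 1 f (df x)) -> (forall x, 0 <= x -> 0 <= df x) ->
  forall x, 0 <= x -> f 0 <= f x.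
Proof.
move=> fdf df0 x x0.
have cf : {within `[0, x], continuous f}.
  apply: continuous_subspaceT => y.
  by apply/differentiable_continuous/derivable1_diffP; case: (fdf y).
have [c c0x fE] := MVT_segment x0 (fun y _ => fdf y) cf.
rewrite -subr_ge0 fE subr0 mulr_ge0// df0//.
by move: c0x; rewrite in_itv/= => /andP[].
Qed.

(** The ratio of the left-hand side to the right-hand side equals [1] at [0]. It
decreases because the logarithmic derivative of the left-hand side is a
logistic function [s] of [l], which starts at [p] and has slope
[s * (1 - s) <= 1 / 4]. *)
Lemma hoeffding_bernoulli_pos (R : realType) (p l : R) : 0 <= p <= 1 -> 0 <= l ->
  1 - p + p * expR l <= expR (p * l + l ^+ 2 / 8).
Proof.
move=> /andP[p0 p1].
pose D y := 1 - p + p * expR y : R.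
have D0 y : 0 < D y.
  rewrite /D; have := expR_gt0 y; have [->|pn0] := eqVneq p 0; first by lra.
  have : 0 < p by rewrite lt_neqAle eq_sym pn0.
  by move=> p0' e0; have := mulr_gt0 p0' e0; lra.
have dD (x : R) : is_derive x 1 D (p * expR x).
  rewrite /D; apply: is_derive_eq.
  by rewrite /GRing.scale/=; ring.
pose q y := p * y + y ^+ 2 / 8 : R.
have dq (x : R) : is_derive x 1 q (p + x / 4).
  rewrite /q; apply: is_derive_eq.
  by rewrite /GRing.scale/=; field.
pose s y := p * expR y / D y.
have ds (x : R) : is_derive x 1 (fun y => p + y / 4 - s y) (4^-1 - s x * (1 - s x)).
  have Dn0 : D x != 0 by rewrite gt_eqF.
  rewrite /s; apply: is_derive_eq.
  by rewrite /GRing.scale/=; field.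
pose M y := - (D y * expR (- q y)).
have dM (x : R) : is_derive x 1 M (D x * expR (- q x) * (p + x / 4 - s x)).
  have Dn0 : D x != 0 by rewrite gt_eqF.
  rewrite /M; apply: is_derive_eq.
  by rewrite /GRing.scale/= /s; field.
have s_le y : 0 <= y -> s y <= p + y / 4.
  move=> y0; rewrite -subr_ge0; apply: le_trans (ge0_derive_ge_at0 ds _ y0).
    by rewrite mul0r /s /D expR0 mulr1 subrK divr1 addr0 subrr.
  by move=> z _; have := sqr_ge0 (s z - 2^-1); nra.
move=> l0.
have : M 0 <= M l.
  apply: (ge0_derive_ge_at0 dM) => // y y0.
  by rewrite !mulr_ge0 ?expR_ge0 ?subr_ge0 ?s_le// ltW.
have -> : M 0 = - 1.
  by rewrite /M /q /D mulr0 expr0n/= mul0r addr0 oppr0 expR0 !mulr1 subrK.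
by rewrite /M lerN2 expRN ler_pdivrMr ?mul1r// expR_gt0.
Qed.

(** Exchanging success and failure turns a negative [l] into a positive one. *)
Lemma hoeffding_bernoulli (R : realType) (p l : R) : 0 <= p <= 1 ->
  1 - p + p * expR l <= expR (p * l + l ^+ 2 / 8).
Proof.
move=> p01; have [l0|l0] := lerP 0 l; first exact: hoeffding_bernoulli_pos.
have q01 : 0 <= 1 - p <= 1 by move: p01; lra.
have l0' : 0 <= - l by lra.
have := hoeffding_bernoulli_pos q01 l0'.
rewrite -(ler_pM2r (expR_gt0 l)) -expRD mulrDl -mulrA -expRD addNr expR0.
have -> : (1 - p) * - l + (- l) ^+ 2 / 8 + l = p * l + l ^+ 2 / 8 by ring.
by apply: le_trans; lra.
Qed.

(** * Numerical estimates *)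

(** The true values are about 0.037 and 0.090, so crude bounds suffice:
[exp (1 / 2) >= 3 / 2] and [sqrt 6 >= 2.44]. *)
Lemma sikkema_excess (R : realType) : 2 * expR (- 4) <= (sikkema - 1 : R).
Proof.
have s6 : 244 / 100 <= Num.sqrt 6 :> R.
  rewrite -[leLHS]ger0_norm; last by lra.
  by rewrite -sqrtr_sqr ler_wsqrtr//; lra.
have e4 : 25 <= expR 4 :> R.
  have -> : 4 = 8%:R * 2^-1 :> R by lra.
  rewrite expRM_natl (@le_trans _ _ ((3 / 2) ^+ 8))//; first by lra.
  rewrite lerXn2r ?nnegrE ?expR_ge0//; try lra.
  by apply: le_trans (expR_ge1Dx _); lra.
have : expR (- 4) <= 25^-1 :> R by rewrite expRN lef_pV2 ?posrE ?expR_gt0//.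
by rewrite /sikkema; lra.
Qed.

(** With [q = sqrt (1 - r)] the claim reads
[2 * q <= exp ((2 - 3 * r / 2) * t)]. The exponent is smallest at [t = 1], where
it equals [(1 + 3 * q ^+ 2) / 2], and [1 + y <= exp y] reduces the claim to
[2 * q <= (3 + 3 * q ^+ 2) / 2]. *)
Lemma two_tails_le (R : realType) (r t : R) : 0 < r < 1 -> 1 <= t ->
  2 * expR (- (2 * t)) <= (Num.sqrt (1 - r))^-1 * expR (- (3 * r / 2 * t)).
Proof.
move=> /andP[r0 r1] t1; set q := Num.sqrt _.
have q0 : 0 < q by rewrite sqrtr_gt0 subr_gt0.
have qE : q ^+ 2 = 1 - r by rewrite sqr_sqrtr// subr_ge0 ltW.
rewrite ler_pdivlMl//.
have -> : - (3 * r / 2 * t) = - (2 * t) + (2 - 3 * r / 2) * t by lra.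
rewrite expRD mulrA [leRHS]mulrC ler_pM2r ?expR_gt0//.
apply: le_trans (expR_ge1Dx _).
have : 0 <= (2 - 3 * r / 2) * (t - 1) by rewrite mulr_ge0; lra.
have := sqr_ge0 (q - 1); nra.
Qed.

(** Maximising over [r] at [t = 2] shows that the constant [6] could be
replaced by about 4.97; [6] is the value of [n + 1] at [n = 5]. *)
Lemma bound_ge1 (R : realType) (r t : R) : 0 < r < 1 -> t <= 2 ->
  1 <= 6 / Num.sqrt (1 - r) * expR (- (3 * r / 2 * t)).
Proof.
move=> /andP[r0 r1] t2; set q := Num.sqrt _.
have q0 : 0 < q by rewrite sqrtr_gt0 subr_gt0.
have qE : q ^+ 2 = 1 - r by rewrite sqr_sqrtr// subr_ge0 ltW.
have H : expR (- (3 * r)) <= expR (- (3 * r / 2 * t)).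
  by rewrite ler_expR; nra.
suff : q <= 6 * expR (- (3 * r)).
  move=> H2; rewrite mulrAC ler_pdivlMr// mul1r (le_trans H2)// ler_pM2l//.
(* After squaring, the claim is [s * exp (6 - 6 * s) <= 36] with [s = 1 - r]. The
   maximum over [s] is at [6 * s = 1], hence the splitting of the exponent into
   [6 * s - 1] and [- 5]: the tangent bound [1 + y <= exp y] is sharp there. *)
rewrite -(@ler_pXn2r _ 2)// ?nnegrE ?mulr_ge0 ?expR_ge0 ?(ltW q0)//.
rewrite exprMn qE -expRM_natl.
have -> : 2%:R * - (3 * r) = (6 * (1 - r) - 1) + (- 5) :> R by lra.
rewrite expRD.
have e5 : 216^-1 <= expR (- 5) :> R.
  have -> : - 5 = 40%:R * - 8^-1 :> R by lra.
  rewrite expRM_natl (@le_trans _ _ ((7 / 8) ^+ 40))//; first by lra.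
  rewrite lerXn2r ?nnegrE ?expR_ge0//; try lra.
  by apply: le_trans (expR_ge1Dx _); lra.
have e1 := expR_ge1Dx (6 * (1 - r) - 1).
have : 0 <= (expR (6 * (1 - r) - 1) - 6 * (1 - r)) * expR (- 5).
  by rewrite mulr_ge0 ?expR_ge0//; lra.
have : 0 <= 6 * (1 - r) * (expR (- 5) - 216^-1) by rewrite mulr_ge0; lra.
lra.
Qed.

(** * Concave distortions *)

(** By concavity the slope [u p / p] of a chord is at most the slope [u h / h] of
any shorter one, and these tend to the derivative at [0]. *)
Lemma concave_le_tangent (R : realType) (u : R -> R) (du0 : R) :
  concave_on `[0, 1] u -> u 0 = 0 -> has_right_derivative u 0 du0 ->
  forall p, 0 <= p <= 1 -> u p <= du0 * p.
Proof.
move=> ucv u0 udu p /andP[]; rewrite le_eqVlt => /predU1P[<- _|p0 p1].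
  by rewrite u0 mulr0.
rewrite -ler_pdivrMr//.
have <- : lim (h^-1 * (u (0 + h) - u 0) @[h --> 0^'+]) = du0.
  by apply/cvg_lim.
apply: limr_ge; first by apply/cvg_ex; exists du0.
near=> h.
have h0 : 0 < h by near: h; exact: nbhs_right_gt.
have hp : h <= p by near: h; exact: nbhs_right_le.
rewrite add0r u0 subr0 [leRHS]mulrC ler_pdivlMr//.
have ht : 0 <= h / p <= 1.
  by rewrite (divr_ge0 (ltW h0) (ltW p0))/= ler_pdivrMr// mul1r.
have := ucv (Itv01 (proj1 (andP ht)) (proj2 (andP ht))) p 0.
rewrite !inE/= !in_itv/= lexx ler01 (ltW p0) p1 => /(_ isT isT).
rewrite !convRE/=.
set c := (X in - u X); have -> : c = h.
  rewrite /c -[LHS]/((h / p) *: p + unstable.onem (h / p) *: 0) scaler0 addr0.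
  by rewrite /GRing.scale/= divfK// gt_eqF.
by rewrite u0 oppr0 mulr0 addr0 mulrN lerN2; have -> : u p / p * h = h / p * u p by ring.
Unshelve. all: by end_near.
Qed.

(** * Tail bound for the number of successes *)

(** The left-hand side is the tail of a binomial law, written as a sum over the
set [J] of successful trials: in this form both the exponential Chebyshev
inequality and the factorisation of the moment generating function are
statements about finite sums. *)
Lemma binomial_tail (R : realType) (I : finType) (p s : R) :
  0 <= p <= 1 -> 0 <= s ->
  \sum_(J : {set I} | #|I|%:R * (p + s) <= #|J|%:R)
     \prod_i (if i \in J then p else 1 - p)
  <= expR (- (2 * #|I|%:R * s ^+ 2)).
Proof.
move=> p01 s0; have /andP[p0 p1] := p01.
pose W (J : {set I}) : R := \prod_i (if i \in J then p else 1 - p).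
have W0 J : 0 <= W J by apply: prodr_ge0 => i _; case: ifP => _ //; rewrite subr_ge0.
pose a : R := #|I|%:R * (p + s).
(* [4 * s] minimises [l ^+ 2 / 8 - l * s]. *)
pose l := 4 * s.
apply: (@le_trans _ _ (\sum_(J : {set I}) W J * expR (l * (#|J|%:R - a)))).
  rewrite big_mkcond ler_sum// => J _; case: ifP => aJ.
    rewrite -[leLHS]mulr1; apply: ler_wpM2l; first exact: W0.
    rewrite -[X in X <= _](@expR0 R) ler_expR mulr_ge0 ?subr_ge0// /l; lra.
  by rewrite mulr_ge0 ?expR_ge0.
have -> : \sum_(J : {set I}) W J * expR (l * (#|J|%:R - a)) =
    (1 - p + p * expR l) ^+ #|I| * expR (- (l * a)).
  rewrite addrC -prodr_const bigA_distr mulr_suml.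
  apply: eq_big => // J _.
  rewrite mulrBr expRD mulrA; congr (_ * _).
  rewrite [l * _]mulrC expRM_natl -prodr_const big_mkcond/= -big_split/=.
  by apply: eq_bigr => i _; case: ifP => _; rewrite ?mulr1.
apply: (@le_trans _ _ (expR (p * l + l ^+ 2 / 8) ^+ #|I| * expR (- (l * a)))).
  rewrite ler_wpM2r ?expR_ge0// lerXn2r ?nnegrE ?expR_ge0 ?hoeffding_bernoulli//.
  by rewrite addr_ge0 ?subr_ge0// mulr_ge0 ?expR_ge0.
rewrite -expRM_natl -expRD ler_expR /a /l le_eqVlt; apply/orP; left.
by apply/eqP; field.
Qed.

Lemma probability_bigsetU_le d (T : measurableType d) (R : realType)
    (P : probability T R) (I : finType) (Q : pred I) (A : I -> set T) :
  (forall i, measurable (A i)) ->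
  (P (\big[setU/set0]_(i | Q i) A i) <= \sum_(i | Q i) P (A i))%E.
Proof.
move=> mA.
suff [] : measurable (\big[setU/set0]_(i | Q i) A i) /\
   (P (\big[setU/set0]_(i | Q i) A i) <= \sum_(i | Q i) P (A i))%E by [].
elim/big_rec2 : _ => [|i x B _ [mB PB]]; first by rewrite measure0.
split; first exact: measurableU.
by rewrite (le_trans (measureU2 _ _ _))// leeD2l.
Qed.

Section CountTail.
Context d (T : measurableType d) (R : realType) (P : probability T R).

(** The event is the union, over the large enough sets [J], of the events that
exactly the variables with index in [J] fall into [B]. Independence, applied to
[B] on [J] and to its complement off [J], gives the probability of each. *)
Lemma independent_count_tail (I : finType) (X : I -> {RV P >-> R}) (B : set R) (p s : R) :
  mutually_independent X -> measurable B -> 0 <= p <= 1 -> 0 <= s ->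
  (forall i, P (X i @^-1` B) = p%:E) ->
  let E := [set w | #|I|%:R * (p + s) <= #|[set i | X i w \in B]%SET|%:R :> R] in
  measurable E /\ (P E <= (expR (- (2 * #|I|%:R * s ^+ 2)))%:E)%E.
Proof.
move=> Xind mB p01 s0 XB E.
pose C (J : {set I}) i := if i \in J then B else ~` B.
have mC J i : measurable (C J i) by rewrite /C; case: ifP => // _; exact: measurableC.
have mX i A : measurable A -> measurable (X i @^-1` A).
  by move=> mA; rewrite -[_ @^-1` _]setTI; exact: measurable_funP.
pose A J := \bigcap_(i in [set i | i \in [set: I]%SET]) (X i @^-1` C J i).
have mA J : measurable (A J).
  by apply: fin_bigcap_measurable => [|i _]; [exact: finite_finset|exact: mX (mC J i)].
have EA : E = \big[setU/set0]_(J : {set I} | #|I|%:R * (p + s) <= #|J|%:R) A J.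
  rewrite -(bigcup_pred (fun J : {set I} => #|I|%:R * (p + s) <= #|J|%:R)).
  apply/seteqP; split => [w Ew|w [J/= EJ AJ]].
    exists [set i | X i w \in B]%SET => // i _.
    by rewrite /C/= inE; case: ifPn; rewrite ?inE// notin_setE.
  rewrite /E/=; suff -> : [set i | X i w \in B]%SET = J by [].
  apply/setP => i; rewrite inE; have := AJ i; rewrite /= inE => /(_ isT).
  by rewrite /C; case: ifPn => _ /=; [move/mem_set|rewrite -notin_setE => /negbTE].
have PA J : P (A J) = (\prod_i (if i \in J then p else 1 - p))%:E.
  rewrite /A Xind//.
  rewrite -prodEFin; apply: eq_big => [i|i _]; first by rewrite inE.
  rewrite /C; case: ifP => _; first exact: XB.
  by rewrite preimage_setC probability_setC ?XB//; exact: mX.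
split; first by rewrite EA; exact: bigsetU_measurable.
rewrite EA (le_trans (probability_bigsetU_le _ _ _))//.
under eq_bigr do rewrite PA.
by rewrite sumEFin lee_fin binomial_tail.
Qed.

Lemma uniform01_lt (X : {RV P >-> R}) t : uniform01 X -> 0 <= t <= 1 ->
  P (X @^-1` `]-oo, t[) = t%:E.
Proof.
move=> Xu /andP[t0 t1].
rewrite -[LHS]/(distribution P X `]-oo, t[) Xu// /uniform_prob integral_uniform_pdf.
have -> : `]-oo, t[ `&` `[0, 1] = `[0, t[%classic.
  apply/seteqP; split => x/=; rewrite !in_itv/=; first by case=> ? /andP[-> _].
  by move=> /andP[-> xt]; split=> //; rewrite ltW// (lt_le_trans xt).
rewrite (eq_integral (cst 1%E)); last first.
  move=> x; rewrite inE/= in_itv/= => /andP[x0 xt].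
  by rewrite /uniform_pdf x0/= ltW ?(lt_le_trans xt)// subr0 invr1.
rewrite integral_cst//= mul1e.
rewrite lebesgue_measure_itv/=.
rewrite lte_fin; case: ltgtP t0 => // [t0 _|<- _]; last by [].
by rewrite oppr0 adde0.
Qed.

Lemma uniform01_gt (X : {RV P >-> R}) t : uniform01 X -> 0 <= t <= 1 ->
  P (X @^-1` `]t, +oo[) = (1 - t)%:E.
Proof.
move=> Xu /andP[t0 t1].
rewrite -[LHS]/(distribution P X `]t, +oo[) Xu// /uniform_prob integral_uniform_pdf.
have -> : `]t, +oo[ `&` `[0, 1] = `]t, 1]%classic.
  apply/seteqP; split => x/=; rewrite !in_itv/= andbT; first by case=> -> /andP[_ ->].
  by move=> /andP[tx ->]; split=> //; rewrite andbT ltW// (le_lt_trans t0).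
rewrite (eq_integral (cst 1%E)); last first.
  move=> x; rewrite inE/= in_itv/= => /andP[tx x1].
  by rewrite /uniform_pdf x1 andbT ltW ?(le_lt_trans t0)// subr0 invr1.
rewrite integral_cst//= mul1e.
rewrite lebesgue_measure_itv/=.
by rewrite lte_fin; move: t1; rewrite le_eqVlt => /predU1P[->|->//]; rewrite ltxx subrr.
Qed.
End CountTail.

(** * Order statistics *)

Section OrderStatistics.
Context (R : realType) (m : nat).
Implicit Types (v : 'I_m -> R) (t : R) (k : nat).

Lemma count_sorted_sample v (a : pred R) :
  count a (sort <=%R [seq v j | j <- enum 'I_m]) = #|[set i | a (v i)]%SET|.
Proof.
have /permP -> : perm_eq (sort <=%R [seq v j | j <- enum 'I_m]) [seq v j | j <- enum 'I_m].
  by rewrite perm_sort.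
rewrite count_map enumT cardE /enum_mem size_filter.
by apply: eq_count => i; rewrite /= inE.
Qed.

Lemma order_statistic_gt v k t : (k < m)%N ->
  (t < order_statistic v k) = (#|[set i | (v i <= t)%R]%SET| <= k)%N.
Proof.
move=> km; rewrite /order_statistic -(count_sorted_sample v (<= t)%R).
have ss : sorted <=%R (sort <=%R [seq v j | j <- enum 'I_m]).
  exact: sort_le_sorted.
have sz : size (sort <=%R [seq v j | j <- enum 'I_m]) = m.
  by rewrite size_sort size_map size_enum_ord.
apply/idP/idP => [|ck]; last by apply: nth_count_gt => //; rewrite ck sz.
by apply: contraLR; rewrite -ltnNge -leNgt; exact: nth_count_le.
Qed.

Lemma order_statistic_lt v k t : (k < m)%N ->
  (order_statistic v k < t) = (k < #|[set i | (v i < t)%R]%SET|)%N.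
Proof.
move=> km; rewrite /order_statistic -(count_sorted_sample v (< t)%R).
have ss : sorted <=%R (sort <=%R [seq v j | j <- enum 'I_m]).
  exact: sort_le_sorted.
have sz : size (sort <=%R [seq v j | j <- enum 'I_m]) = m.
  by rewrite size_sort size_map size_enum_ord.
apply/idP/idP => [|kc]; last exact: nth_count_lt.
by apply: contraLR; rewrite -leqNgt -leNgt => ck; apply: nth_count_ge => //; rewrite ck sz.
Qed.

Lemma order_statistic_in01 v k : (k < m)%N -> (forall i, v i \in `[0, 1]) ->
  order_statistic v k \in `[0, 1].
Proof.
move=> km v01; rewrite in_itv/= 2!leNgt order_statistic_lt// order_statistic_gt// -leqNgt -ltnNge.
have -> : [set i | v i < 0]%SET = finset.set0.
  by apply/setP => i; rewrite !inE; have := v01 i; rewrite in_itv/= ltNge => /andP[->].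
have -> : [set i | v i <= 1]%SET = [set: 'I_m]%SET.
  by apply/setP => i; rewrite !inE; have := v01 i; rewrite in_itv/= => /andP[_ ->].
by rewrite cards0 cardsT card_ord km.
Qed.
End OrderStatistics.

(** By [order_statistic_gt] the superlevel sets of an order statistic are sublevel
sets of a sum of indicator functions. *)
Lemma measurable_order_statistic d (T : measurableType d) (R : realType) (m : nat)
    (X : 'I_m -> T -> R) (k : nat) : (k < m)%N ->
  (forall i, measurable_fun setT (X i)) ->
  measurable_fun setT (fun w => order_statistic (fun i => X i w) k).
Proof.
move=> km mX _; apply: (measurability _ (RGenOInfty.measurableE R)) => //.
move=> _ [_ [t ->] <-]; rewrite setTI.
pose N (w : T) : R := \sum_(i < m) \1_(X i @^-1` `]-oo, t]) w.
have mN : measurable_fun setT N.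
  apply: measurable_sum => i; apply: measurable_indic.
  by rewrite -[_ @^-1` _]setTI; exact: mX.
have NE w : N w = #|[set i | (X i w <= t)%R]%SET|%:R.
  rewrite /N -sum1_card natr_sum [RHS]big_mkcond/=; apply: eq_bigr => i _.
  rewrite indicE inE; have -> : (w \in X i @^-1` `]-oo, t]) = (X i w <= t).
    by apply/idP/idP; rewrite inE/= in_itv.
  by case: ifP.
rewrite [X in measurable X](_ : _ = N @^-1` `]-oo, k%:R]).
  by rewrite -[_ @^-1` _]setTI; exact: mN.
by apply/seteqP; split => w/=; rewrite !in_itv/= andbT order_statistic_gt// NE ler_nat.
Qed.

Section OrderStatisticTails.
Context d (T : measurableType d) (R : realType) (P : probability T R).
Variables (m : nat) (X : 'I_m -> {RV P >-> R}).
Hypotheses (X01 : forall i w, X i w \in `[0, 1]).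
Hypotheses (X_unif : forall i, uniform01 (X i)).
Hypothesis X_indep : mutually_independent X.

Let OS k w : R := order_statistic (fun i => X i w) k.

Lemma measurable_sample_order_statistic k : (k < m)%N -> measurable_fun setT (OS k).
Proof. by move=> km; exact: measurable_order_statistic. Qed.

(** The event says that at least [m - k] variables exceed [t], whereas
[m * (1 - t)] of them are expected to; the last hypothesis says that the excess
is at least [m * s]. *)
Lemma order_statistic_upper_tail k (t s : R) : (k < m)%N -> 0 <= t -> 0 <= s ->
  k%:R + m%:R * s <= m%:R * t ->
  (P [set w | (t < OS k w)%R] <= (expR (- (2 * m%:R * s ^+ 2)))%:E)%E.
Proof.
move=> km t0 s0 H.
have [t1|t1] := lerP 1 t.
  rewrite (_ : mkset _ = set0) ?measure0 ?lee_fin ?expR_ge0//.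
  rewrite -subset0 => w /=; rewrite ltNge; case/negP.
  have := order_statistic_in01 km (X01 ^~ w).
  by rewrite in_itv/= => /andP[_ /le_trans]; apply.
have t01 : 0 <= t <= 1 by rewrite t0 ltW.
have q01 : 0 <= 1 - t <= 1 by lra.
have [mE PE] := independent_count_tail X_indep (measurable_itv `]t, +oo[)
  q01 s0 (fun i => uniform01_gt (X_unif i) t01).
rewrite card_ord in mE PE.
apply: le_trans PE; rewrite le_measure ?inE//.
  rewrite (_ : mkset _ = OS k @^-1` `]t, +oo[).
    by rewrite -[_ @^-1` _]setTI; exact: measurable_sample_order_statistic.
  by apply/seteqP; split => w/=; rewrite in_itv/= andbT.
move=> w /=; rewrite /OS order_statistic_gt// => ck.
have ceq : (#|[set i | (X i w <= t)%R]%SET| + #|[set i | X i w \in `]t, +oo[%classic]%SET| = m)%N.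
  rewrite -[RHS]card_ord -(cardsC [set i | (X i w <= t)%R]%SET); congr addn.
  apply: eq_card => i; rewrite !inE -ltNge; apply/idP/idP; rewrite inE/= in_itv/= andbT//.
have : (m%:R : R) <= k%:R + #|[set i | X i w \in `]t, +oo[%classic]%SET|%:R.
  by rewrite -natrD ler_nat -{1}ceq leq_add2r.
lra.
Qed.

Lemma order_statistic_lower_tail k (t s : R) : (k < m)%N -> t <= 1 -> 0 <= s ->
  m%:R * t + m%:R * s <= k.+1%:R ->
  (P [set w | (OS k w < t)%R] <= (expR (- (2 * m%:R * s ^+ 2)))%:E)%E.
Proof.
move=> km t1 s0 H.
have [t0|t0] := lerP t 0.
  rewrite (_ : mkset _ = set0) ?measure0 ?lee_fin ?expR_ge0//.
  rewrite -subset0 => w /=; rewrite ltNge; case/negP.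
  have := order_statistic_in01 km (X01 ^~ w).
  by rewrite in_itv/= => /andP[+ _]; apply: le_trans.
have t01 : 0 <= t <= 1 by rewrite t1 ltW.
have [mE PE] := independent_count_tail X_indep (measurable_itv `]-oo, t[)
  t01 s0 (fun i => uniform01_lt (X_unif i) t01).
rewrite card_ord in mE PE.
apply: le_trans PE; rewrite le_measure ?inE//.
  rewrite (_ : mkset _ = OS k @^-1` `]-oo, t[).
    by rewrite -[_ @^-1` _]setTI; exact: measurable_sample_order_statistic.
  by apply/seteqP; split => w/=; rewrite in_itv.
move=> w /=; rewrite /OS order_statistic_lt// => ck.
rewrite (_ : [set i | X i w \in _]%SET = [set i | (X i w < t)%R]%SET); last first.
  by apply/setP => i; rewrite !inE; apply/idP/idP; rewrite inE/= in_itv.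
by rewrite mulrDr (le_trans H)// ler_nat.
Qed.
End OrderStatisticTails.

(** * Bernstein operators *)

Section Bernstein.
Context (R : realType).

Lemma bernstein_ge0 k n (x : R) : x \in `[0, 1] -> 0 <= bernstein k n x.
Proof.
by rewrite in_itv/= => /andP[x0 x1]; rewrite !mulr_ge0 ?exprn_ge0 ?subr_ge0.
Qed.

(** The binomial theorem; this is the moment generating function of the binomial
law with parameters [n] and [x]. *)
Lemma bernstein_exp_sum n (x l : R) :
  \sum_(0 <= k < n.+1) expR (l * k%:R) * bernstein k n x = (1 - x + x * expR l) ^+ n.
Proof.
rewrite exprDn big_mkord; apply: eq_bigr => k _.
by rewrite /bernstein expRM_natr exprMn -[RHS]mulr_natl; ring.
Qed.

Lemma bernstein_sum1 n (x : R) : \sum_(0 <= k < n.+1) bernstein k n x = 1.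
Proof.
have := bernstein_exp_sum n x 0; rewrite expR0 mulr1 subrK expr1n => <-.
by apply: eq_bigr => k _; rewrite mul0r expR0 mul1r.
Qed.

Lemma bernstein_mgf n (x l : R) : x \in `[0, 1] ->
  \sum_(0 <= k < n.+1) expR (l * (k%:R - n%:R * x)) * bernstein k n x <=
    expR (n%:R * (l ^+ 2 / 8)).
Proof.
rewrite in_itv/= => x01.
under eq_bigr do rewrite mulrBr expRD mulrAC.
rewrite -mulr_suml bernstein_exp_sum expRN ler_pdivrMr ?expR_gt0// -expRD.
have -> : n%:R * (l ^+ 2 / 8) + l * (n%:R * x) = n%:R * (x * l + l ^+ 2 / 8) by ring.
rewrite expRM_natl lerXn2r ?nnegrE ?expR_ge0 ?hoeffding_bernoulli//.
by case/andP: x01 => x0 x1; rewrite addr_ge0 ?subr_ge0// mulr_ge0 ?expR_ge0.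
Qed.

Variables (g : R -> R) (delta kappa : R).
Hypothesis delta_gt0 : 0 < delta.
Hypothesis g_osc : forall x y : R, x \in `[0, 1] -> y \in `[0, 1] ->
  `|x - y| <= delta -> `|g x - g y| <= kappa.

Let kappa_ge0 : 0 <= kappa.
Proof.
have i0 : (0 : R) \in `[0, 1] by rewrite in_itv/= lexx ler01.
by apply: le_trans (g_osc i0 i0 _); rewrite // subrr normr0 ltW.
Qed.

(** The segment from [x] to [y] splits into [m + 1] steps of length at most
[delta]. *)
Lemma oscillation_chain m (x y : R) : x \in `[0, 1] -> y \in `[0, 1] ->
  `|x - y| <= m.+1%:R * delta -> `|g x - g y| <= m.+1%:R * kappa.
Proof.
move=> x01; elim: m y => [|m IH] y y01 xy; first by rewrite mul1r g_osc// -[leRHS]mul1r.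
pose z := x + m.+1%:R / m.+2%:R * (y - x).
have q01 : 0 <= (m.+1%:R / m.+2%:R : R) <= 1.
  by rewrite divr_ge0//= ler_pdivrMr// mul1r ler_nat.
have z01 : z \in `[0, 1].
  move: q01 x01 y01; rewrite /z; set q := (_ / _); rewrite !in_itv/=.
  by move=> /andP[? ?] /andP[? ?] /andP[? ?]; apply/andP; split; nra.
have m20 : m.+2%:R != 0 :> R by rewrite pnatr_eq0.
have xz : `|x - z| <= m.+1%:R * delta.
  have -> : x - z = m.+1%:R / m.+2%:R * (x - y) by rewrite /z; ring.
  rewrite normrM ger0_norm; last by case/andP: q01.
  by rewrite -mulrA ler_pM2l// mulrC ler_pdivrMr// mulrC.
have zy : `|z - y| <= delta.
  have -> : z - y = m.+2%:R^-1 * (x - y).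
    by rewrite /z; field; rewrite -natrD pnatr_eq0.
  by rewrite normrM ger0_norm ?invr_ge0// mulrC ler_pdivrMr// mulrC.
rewrite -[g x](subrK (g z)) -addrA (le_trans (ler_normD _ _))//.
by rewrite -[m.+2]addn1 natrD mulrDl mul1r lerD ?IH ?g_osc.
Qed.

(** Let [t = (y - x) / delta]. By [oscillation_chain] the increment of [g] is at
most [1 + m] times [kappa], where [m] is the integer part of [|t|]; and [m] is
zero unless [|t| >= 1], in which case
[m <= 1 + a * (|t| - 1) <= exp (a * (|t| - 1))]. The two exponentials, one for
each sign of [t], have computable binomial means. *)
Lemma oscillation_exp (a x y : R) : 1 <= a -> x \in `[0, 1] -> y \in `[0, 1] ->
  `|g y - g x| <= kappa * (1 + (expR (a * ((y - x) / delta - 1)) +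
                                expR (a * (- ((y - x) / delta) - 1)))).
Proof.
move=> a1 x01 y01; set t := (y - x) / delta.
have tn : `|y - x| = `|t| * delta.
  by rewrite /t normrM normfV (gtr0_norm delta_gt0) divfK// gt_eqF.
have e1 := expR_ge0 (a * (t - 1)); have e2 := expR_ge0 (a * (- t - 1)).
have /andP[tl tu] := truncn_itv (normr_ge0 t).
have H : `|g y - g x| <= (Num.truncn `|t|).+1%:R * kappa.
  by apply: oscillation_chain => //; rewrite tn ler_pM2r// ltW.
rewrite (le_trans H)// mulrC ler_wpM2l// -natr1 addrC lerD2l.
case: (Num.truncn `|t|) tl => [|m] tl; first by rewrite addr_ge0.
have t1 : 1 <= `|t| by rewrite (le_trans _ tl)// ler1n.
apply: (@le_trans _ _ (expR (a * (`|t| - 1)))).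
  apply: le_trans (expR_ge1Dx _); apply: (le_trans tl); nra.
case: (ger0P t) => t0.
  by rewrite lerDl.
by rewrite lerDr.
Qed.

(** In [oscillation_exp] the choice [a = 4 * n * delta ^+ 2] makes
[a * (y - x) / delta] at [y = k / n] equal to [4 * delta * (k - n * x)], and
Hoeffding's bound for the parameter [4 * delta] is
[exp (2 * n * delta ^+ 2)]; the factor [exp (- a)] leaves
[exp (- 2 * n * delta ^+ 2)]. *)
Lemma bernstein_oscillation n (x : R) : (0 < n)%N -> 1 <= 4 * n%:R * delta ^+ 2 -> x \in `[0, 1] ->
  \sum_(0 <= k < n.+1) `|g (k%:R / n%:R) - g x| * bernstein k n x <=
  kappa * (1 + 2 * expR (- (2 * n%:R * delta ^+ 2))).
Proof.
move=> n0 a1 x01.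
have n0' : n%:R != 0 :> R by rewrite pnatr_eq0 -lt0n.
have d0 : delta != 0 by rewrite gt_eqF.
pose c := expR (- (4 * n%:R * delta ^+ 2)).
pose h l k := expR (l * (k%:R - n%:R * x)).
apply: (@le_trans _ _ (\sum_(0 <= k < n.+1)
   (kappa * bernstein k n x + kappa * c * (h (4 * delta) k * bernstein k n x)
      + kappa * c * (h (- (4 * delta)) k * bernstein k n x)))).
  rewrite big_nat [leRHS]big_nat ler_sum// => k kn.
  have k01 : (k%:R / n%:R : R) \in `[0, 1].
    by rewrite in_itv/= divr_ge0//= ler_pdivrMr ?ltr0n// mul1r ler_nat -ltnS.
  apply: le_trans (ler_wpM2r (bernstein_ge0 _ _ x01) (oscillation_exp a1 x01 k01)) _.
  have -> : 4 * n%:R * delta ^+ 2 * ((k%:R / n%:R - x) / delta - 1) =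
     - (4 * n%:R * delta ^+ 2) + 4 * delta * (k%:R - n%:R * x).
    by field; rewrite n0' d0.
  have -> : 4 * n%:R * delta ^+ 2 * (- ((k%:R / n%:R - x) / delta) - 1) =
     - (4 * n%:R * delta ^+ 2) + - (4 * delta) * (k%:R - n%:R * x).
    by field; rewrite n0' d0.
  by rewrite !expRD -/c -/(h _ _) le_eqVlt; apply/orP; left; apply/eqP; rewrite /h; ring.
rewrite !big_split/= -!mulr_sumr bernstein_sum1.
have P l : l ^+ 2 = 16 * delta ^+ 2 ->
    \sum_(0 <= k < n.+1) h l k * bernstein k n x <= expR (2 * n%:R * delta ^+ 2).
  move=> lE; apply: le_trans (bernstein_mgf _ _ x01) _.
  by rewrite lE ler_expR; lra.
have c0 : 0 <= kappa * c by rewrite mulr_ge0// expR_ge0.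
have H1 := ler_wpM2l c0 (P (4 * delta) ltac:(ring)).
have H2 := ler_wpM2l c0 (P (- (4 * delta)) ltac:(ring)).
have cE : kappa * c * expR (2 * n%:R * delta ^+ 2) = kappa * expR (- (2 * n%:R * delta ^+ 2)).
  by rewrite -mulrA -expRD; congr (_ * expR _); ring.
move: H1 H2; rewrite cE; lra.
Qed.

Lemma bernstein_dist_le n (y : nat -> R) (x e : R) : x \in `[0, 1] ->
  \sum_(0 <= k < n.+1) `|g (y k) - g x| * bernstein k n x <= e ->
  `|\sum_(0 <= k < n.+1) g (y k) * bernstein k n x - g x| <= e.
Proof.
move=> x01; apply: le_trans.
rewrite -[g x in leLHS]mulr1 -(bernstein_sum1 n x) mulr_sumr -sumrB.
rewrite (le_trans (ler_norm_sum _ _ _))// ler_sum// => k _.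
by rewrite -mulrBl normrM (ger0_norm (bernstein_ge0 _ _ x01)).
Qed.

Lemma bernstein_node_error n (y : nat -> R) (x : R) : (0 < n)%N ->
  1 <= 4 * n%:R * delta ^+ 2 -> x \in `[0, 1] ->
  (forall k, (k <= n)%N -> y k \in `[0, 1] /\ `|y k - k%:R / n%:R| <= delta) ->
  `|\sum_(0 <= k < n.+1) g (y k) * bernstein k n x - g x| <=
  kappa * (2 + 2 * expR (- (2 * n%:R * delta ^+ 2))).
Proof.
move=> n0 a1 x01 yP; apply: bernstein_dist_le => //.
have -> : kappa * (2 + 2 * expR (- (2 * n%:R * delta ^+ 2))) = kappa * 1 +
  kappa * (1 + 2 * expR (- (2 * n%:R * delta ^+ 2))) by ring.
apply: le_trans (lerD (lexx _) (bernstein_oscillation n0 a1 x01)).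
rewrite -[X in kappa * X](bernstein_sum1 n x) mulr_sumr -big_split/= big_nat [leRHS]big_nat.
rewrite ler_sum// => k; rewrite ltnS/= => kn.
have [yk01 ykd] := yP _ kn.
have k01 : (k%:R / n%:R : R) \in `[0, 1].
  by rewrite in_itv/= divr_ge0//= ler_pdivrMr ?ltr0n// mul1r ler_nat.
rewrite -mulrDl ler_wpM2r ?bernstein_ge0//.
rewrite -[g (y k)](subrK (g (k%:R / n%:R))) -addrA.
by rewrite (le_trans (ler_normD _ _))// lerD2r g_osc.
Qed.

Lemma bernstein_coarse_error n (y : nat -> R) (x : R) : 1 <= 2 * delta ->
  x \in `[0, 1] -> (forall k, (k <= n)%N -> y k \in `[0, 1]) ->
  `|\sum_(0 <= k < n.+1) g (y k) * bernstein k n x - g x| <= kappa * 2.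
Proof.
move=> d1 x01 y01; apply: bernstein_dist_le => //.
rewrite -[leRHS]mulr1 -[X in kappa * 2 * X](bernstein_sum1 n x) mulr_sumr big_nat [leRHS]big_nat.
rewrite ler_sum// => k; rewrite ltnS/= => kn.
rewrite ler_wpM2r ?bernstein_ge0// [leRHS]mulrC; apply: (@oscillation_chain 1); rewrite ?y01//.
apply: le_trans d1; have := y01 _ kn; move: x01; rewrite !in_itv/=.
by move=> /andP[? ?] /andP[? ?]; rewrite ler_norml; apply/andP; split; lra.
Qed.
End Bernstein.

(** * Measurability of the error event *)

Section Measurability.
Context (R : realType).

Let grid (m : nat) (t : R) : R := (Num.truncn (m.+1%:R * t))%:R / m.+1%:R.

Lemma grid_le m (t : R) : t \in `[0, 1] ->
  (Num.truncn (m.+1%:R * t) <= m.+1)%N.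
Proof.
rewrite in_itv/= => /andP[t0 t1].
rewrite -(@ler_nat R) (@le_trans _ _ (m.+1%:R * t))//; last by rewrite ler_piMr.
by rewrite truncn_le mulr_ge0.
Qed.

Lemma grid_in01 m (i : nat) : (i <= m.+1)%N -> (i%:R / m.+1%:R : R) \in `[0, 1].
Proof.
by move=> im; rewrite in_itv/= divr_ge0//= ler_pdivrMr// mul1r ler_nat.
Qed.

Lemma grid_dist m (t : R) : t \in `[0, 1] -> `|grid m t - t| < m.+1%:R^-1.
Proof.
rewrite in_itv/= => /andP[t0 t1].
have m0 : 0 < m.+1%:R :> R by [].
have /andP[l u] := truncn_itv (mulr_ge0 (ltW m0) t0).
rewrite distrC ger0_norm; last first.
  rewrite subr_ge0 /grid ler_pdivrMr//. by rewrite [leRHS]mulrC.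
by rewrite /grid ltrBlDr -[X in X + _]mul1r -mulrDl ltr_pdivlMr// nat1r [ltLHS]mulrC.
Qed.

Context d (T : measurableType d).

(** [f] is measurable in the sample point and continuous in the space variable.
Rounding [Y] down to a grid gives a function that involves only finitely many of
the functions [f x], and continuity allows the mesh to tend to [0]. *)
Lemma measurable_fun_comp_random (f : R -> T -> R) (Y : T -> R) :
  random_function f -> continuous_uniformly_in_omega f ->
  measurable_fun setT Y -> (forall w, Y w \in `[0, 1]) ->
  measurable_fun setT (fun w => f (Y w) w).
Proof.
move=> mf cf mY Y01.
apply: (@measurable_fun_cvg _ _ _ _ (fun m w => f (grid m (Y w)) w)) => [m|w _].
  pose A (i : nat) := [set w | Num.truncn (m.+1%:R * Y w) = i].
  have mA i : measurable (A i).
    pose Z w : R := m.+1%:R * Y w.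
    have mZ : measurable_fun setT Z by apply: measurable_funM.
    have -> : A i = Z @^-1` `[i%:R, i.+1%:R[.
      apply/seteqP; split => w; rewrite /A /Z/= in_itv/=.
        by move=> <-; rewrite truncn_itv// mulr_ge0//; have := Y01 w; rewrite in_itv => /andP[].
      exact: truncn_def.
    by rewrite -[_ @^-1` _]setTI; exact: mZ.
  have -> : (fun w => f (grid m (Y w)) w) =
      (fun w => \sum_(i < m.+2) f (i%:R / m.+1%:R) w * \1_(A i) w).
    apply/funext => w.
    have im := grid_le m (Y01 w); rewrite -ltnS in im.
    rewrite (bigD1 (Ordinal im))//= big1 ?addr0.
      by rewrite indicE mem_set ?mulr1.
    move=> i; rewrite -val_eqE/= indicE => /negbTE im'; rewrite memNset ?mulr0//.
    by rewrite /A/= => iE; rewrite -iE eqxx in im'.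
  apply: measurable_sum => i; apply: measurable_funM.
    by apply: mf; apply: grid_in01; rewrite -ltnS.
  exact: measurable_indic.
apply/cvgrPdistC_lt => e e0.
have [dl dl0 H] := cf _ (Y01 w) _ e0.
near=> m; apply: H; first exact/grid_in01/grid_le.
apply: lt_trans (grid_dist _ (Y01 w)) _.
near: m; exact: (near_infty_natSinv_lt (PosNum dl0)).
Unshelve. all: by end_near.
Qed.

Variables (n : nat) (f : R -> T -> R) (Y : nat -> nat -> T -> R).
Hypotheses (mf : random_function f) (cf : continuous_uniformly_in_omega f).
Hypotheses (mY : forall k, (k <= n)%N -> measurable_fun setT (Y n k)).
Hypotheses (Y01 : forall k w, (k <= n)%N -> Y n k w \in `[0, 1]).

Lemma measurable_stochastic_bernstein x :
  measurable_fun setT (stochastic_bernstein n f Y x).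
Proof.
rewrite (_ : stochastic_bernstein _ _ _ _ =
  (fun w => \sum_(k < n.+1) f (Y n k w) w * bernstein k n x)); last first.
  by apply/funext => w; rewrite /stochastic_bernstein big_mkord.
apply: measurable_sum => k; apply: measurable_funM => //.
by apply: measurable_fun_comp_random => // [|w]; [apply: mY|apply: Y01]; rewrite -ltnS.
Qed.

Lemma continuous_stochastic_bernstein w : continuous (fun x => stochastic_bernstein n f Y x w).
Proof.
pose p : {poly R} := \sum_(0 <= k < n.+1)
  (f (Y n k w) w * 'C(n, k)%:R)%:P * ('X^k * (1 - 'X) ^+ (n - k)).
rewrite (_ : (fun x => _) = horner p); first exact: continuous_horner.
apply/funext => x; rewrite /p horner_sum; apply: eq_bigr => k _.
by rewrite /bernstein !hornerE.
Qed.

(** The error is continuous in [x], so when its supremum exceeds [C], the error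
itself exceeds [C] at some point of a rational grid; the event is a countable
union over these points. *)
Lemma measurable_sup_error (C : R) :
  measurable [set w | (C%:E < sup_error n f Y w)%E].
Proof.
pose B x w := stochastic_bernstein n f Y x w.
pose G x w := `|B x w - f x w|.
rewrite [X in measurable X](_ : _ = \bigcup_m \bigcup_(i in [set i | (i <= m.+1)%N])
   [set w | C < G (i%:R / m.+1%:R) w]).
  apply: bigcup_measurable => m _; apply: bigcup_measurable => i /= im.
  rewrite (_ : mkset _ = G (i%:R / m.+1%:R) @^-1` `]C, +oo[).
    rewrite -[_ @^-1` _]setTI.
    apply: (measurableT_comp (@normr_measurable _ _)) => //.
    apply: measurable_funB; first exact: measurable_stochastic_bernstein.
    exact/mf/grid_in01.
  by apply/seteqP; split => w/=; rewrite in_itv/= andbT.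
apply/seteqP; split => w /=; last first.
  move=> [m _ [i /= im CG]]; apply/ereal_sup_gtP.
  by exists (G (i%:R / m.+1%:R) w)%:E; [exists (i%:R / m.+1%:R) => //; exact: grid_in01|].
move=> /ereal_sup_gtP[_ [x /= x01 <-]]; rewrite lte_fin -/(G x w) => CG.
pose e := (G x w - C) / 2.
have e0 : 0 < e by rewrite divr_gt0// subr_gt0.
have [d1 d10 H1] := cf x01 e0.
have /cvgrPdist_lt/(_ e e0)/nbhs_ballP[d2 /= d20 H2] := @continuous_stochastic_bernstein w x.
have d0 : 0 < Num.min d1 d2 by rewrite lt_min d10.
have [m _ /(_ m (leqnn m)) /= mlt] := near_infty_natSinv_lt (PosNum d0).
exists m => //; exists (Num.truncn (m.+1%:R * x)); first exact: grid_le.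
rewrite /= -/(grid m x); have gd := lt_trans (grid_dist m x01) mlt.
move: gd; rewrite lt_min => /andP[gd1 gd2].
have := H1 w (grid m x) (grid_in01 (grid_le m x01)) gd1.
have := H2 (grid m x); rewrite /ball/= distrC => /(_ gd2).
rewrite -/(B _ _) -/(B _ _) /G => B1 F1.
have : `|B x w - f x w| <= `|B (grid m x) w - f (grid m x) w| +
     (`|B x w - B (grid m x) w| + `|f (grid m x) w - f x w|).
  have -> : B x w - f x w = (B (grid m x) w - f (grid m x) w) +
     ((B x w - B (grid m x) w) + (f (grid m x) w - f x w)) by ring.
  by rewrite (le_trans (ler_normD _ _))// lerD2l ler_normD.
by move: B1 F1; rewrite /e /G; lra.
Qed.
End Measurability.

(** * The modulus of continuity and the error bound *)

Section Suprema.
Context (R : realType) (T : Type) (f : R -> T -> R) (delta : R).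

Lemma modulus_ge (x y : R) w : x \in `[0, 1] -> y \in `[0, 1] -> `|x - y| <= delta ->
  ((`|f x w - f y w|)%:E <= modulus f delta)%E.
Proof.
move=> x01 y01 xy.
apply: (@le_trans _ _ (ereal_sup [set (`|f xy.1 w - f xy.2 w|)%:E | xy in
      [set xy : R * R | [/\ xy.1 \in `[0, 1], xy.2 \in `[0, 1]
                          & `|xy.1 - xy.2| <= delta]]])).
  by apply: ereal_sup_ubound; exists (x, y).
by apply: ereal_sup_ubound; exists w.
Qed.

Lemma sup_error_le (n : nat) (Y : nat -> nat -> T -> R) w (C : R) :
  (forall x, x \in `[0, 1] -> `|stochastic_bernstein n f Y x w - f x w| <= C) ->
  (sup_error n f Y w <= C%:E)%E.
Proof.
by move=> H; apply: ge_ereal_sup => _ [x /= x01 <-]; rewrite lee_fin H.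
Qed.
End Suprema.

Theorem theorem6 (R : realType) (tau : nat -> R)
    (tau_infty : tau n @[n --> \oo] --> +oo)
    (tau_div_n : tau n / n%:R @[n --> \oo] --> (0 : R))
    (tau_ge1 : forall n : nat, (0 < n)%N -> 1 <= tau n)
    (d : measure_display) (T : measurableType d) (P : probability T R)
    (u : R -> R) (du0 : R)
    (u_incr : {in `[0, 1] &, {homo u : x y / x < y}})
    (u_concave : concave_on `[0, 1] u)
    (u0 : u 0 = 0) (u1 : u 1 = 1)
    (u_deriv0 : has_right_derivative u 0 du0) (du0_gt0 : 0 < du0)
    (V : forall n : nat, 'I_n.+1 -> {RV P >-> R})
    (V01 : forall (n : nat) (j : 'I_n.+1) (w : T), (0 < n)%N ->
       V n j w \in `[0, 1])
    (V_unif : forall (n : nat) (j : 'I_n.+1), (0 < n)%N -> uniform01 (V n j))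
    (V_indep : forall n : nat, (0 < n)%N -> mutually_independent (V n))
    (f : R -> T -> R)
    (f_random : random_function f)
    (f_cont : continuous_uniformly_in_omega f)
    (r : R) (r_gt0 : 0 < r) (r_lt1 : r < 1)
    (n : nat) (n_gt0 : (0 < n)%N) :
  let Y := uniform_array (fun m j => V m j : T -> R) in
  let E := [set w : T | ((1 + sikkema)%:E * modulus f (Num.sqrt (tau n / n%:R))
                         < sup_error n f Y w)%E] in
  measurable E /\
  distorted u P E <=
    du0 * (n.+1%:R / Num.sqrt (1 - r)) * expR (- (3%:R * r / 2%:R * tau n)).
Proof.
move=> Y E.
pose delta := Num.sqrt (tau n / n%:R).
have tau1 := tau_ge1 _ n_gt0.
have n0 : 0 < n%:R :> R by rewrite ltr0n.
have delta2 : n%:R * delta ^+ 2 = tau n.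
  rewrite /delta sqr_sqrtr; first by rewrite mulrC divfK// gt_eqF.
  by rewrite ltW// divr_gt0//; lra.
have delta0 : 0 < delta by rewrite sqrtr_gt0 divr_gt0//; lra.

have Y01 k w : (k <= n)%N -> Y n k w \in `[0, 1].
  by move=> kn; apply: order_statistic_in01 => // i; exact: V01.
have mY k : (k <= n)%N -> measurable_fun setT (Y n k).
  by move=> kn; apply: measurable_order_statistic.
have sik : 2 * expR (- 4) <= (sikkema - 1 : R) := @sikkema_excess R.
have sik1 : 0 < 1 + sikkema :> R by have := expR_gt0 (- 4 : R); lra.
set rhs := du0 * _ * _.
have rhs0 : 0 <= rhs by rewrite !mulr_ge0 ?expR_ge0 ?invr_ge0 ?sqrtr_ge0// ltW.
pose w0 : T := point.
have i0 : (0 : R) \in `[0, 1] by rewrite in_itv/= lexx ler01.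
have K0 : (0 <= modulus f delta)%E.
  apply: le_trans (modulus_ge _ w0 i0 i0 _); first by rewrite lee_fin.
  by rewrite subrr normr0 ltW.
have empty : E = set0 -> measurable E /\ distorted u P E <= rhs.
  by move=> ->; split => //; rewrite /distorted measure0 u0.
(* If the modulus is infinite, no error exceeds it. *)
case KE : (modulus f delta) K0 => [kappa| |] // K0; last first.
  apply: empty; rewrite -subset0 => w; rewrite /E/= -/delta KE gt0_muley ?lte_fin//.
  by rewrite ltNge leey.
have EE : E = [set w | (((1 + sikkema) * kappa)%:E < sup_error n f Y w)%E].
  by rewrite /E -/delta KE EFinM.
have osc w (x y : R) : x \in `[0, 1] -> y \in `[0, 1] -> `|x - y| <= delta ->
    `|f x w - f y w| <= kappa.
  by move=> x01 y01 xy; rewrite -lee_fin -KE modulus_ge.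
have kappa0 : 0 <= kappa by rewrite -lee_fin.
have sub w C : (forall x, x \in `[0, 1] ->
    `|stochastic_bernstein n f Y x w - f x w| <= kappa * C) -> C <= 1 + sikkema -> ~ E w.
  move=> H CS; rewrite EE/= ltNge; case/negP; apply: sup_error_le => x x01.
  by apply: le_trans (H _ x01) _; rewrite mulrC ler_wpM2r.
have mE : measurable E by rewrite EE; exact: measurable_sup_error.
have [n4|n5] := leqP n 4.
  apply: empty; rewrite -subset0 => w; apply: (sub w 2).
    move=> x x01; apply: (@bernstein_coarse_error _ (f ^~ w) delta kappa (osc w) n
      (fun k => Y n k w)) => //; last first.
      by move=> k kn; exact: Y01.
    have n4' : n%:R <= 4 :> R by rewrite ler_nat.
    have : n%:R * delta ^+ 2 <= 4 * delta ^+ 2 by rewrite ler_wpM2r// sqr_ge0.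
    by rewrite delta2; nra.
  by have := expR_gt0 (- 4 : R); lra.
split=> //.
have PE1 := probability_le1 P mE.
have PE0 := measure_ge0 P E.
have PEf : (fine (P E))%:E = P E.
  by rewrite fineK// fin_num_measure.
have PE01 : 0 <= fine (P E) <= 1 by rewrite -!lee_fin PEf PE0.
rewrite /distorted (le_trans (concave_le_tangent u_concave u0 u_deriv0 PE01))//.
rewrite /rhs -mulrA ler_pM2l//.
have r01 : 0 < r < 1 by rewrite r_gt0.
have [tau2|tau2] := lerP (tau n) 2.
  case/andP: PE01 => _ /le_trans; apply.
  apply: (le_trans (bound_ge1 r01 tau2)).
  by rewrite ler_wpM2r ?expR_ge0// ler_wpM2r ?invr_ge0 ?sqrtr_ge0// ler_nat.
pose U (k : 'I_n.+1) := [set w | k%:R / n%:R + delta < Y n k w].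
pose L (k : 'I_n.+1) := [set w | Y n k w < k%:R / n%:R - delta].
have mU k : measurable (U k).
  rewrite (_ : U k = Y n k @^-1` `]k%:R / n%:R + delta, +oo[).
    by rewrite -[_ @^-1` _]setTI; apply: mY => //; rewrite -ltnS.
  by apply/seteqP; split => w; rewrite /U/= in_itv/= andbT.
have mL k : measurable (L k).
  rewrite (_ : L k = Y n k @^-1` `]-oo, k%:R / n%:R - delta[).
    by rewrite -[_ @^-1` _]setTI; apply: mY => //; rewrite -ltnS.
  by apply/seteqP; split => w; rewrite /L/= in_itv/=.
pose q := expR (- (2 * n.+1%:R * delta ^+ 2)).
have kn1 (k : 'I_n.+1) : 0 <= (k%:R / n%:R : R) <= 1.
  by rewrite divr_ge0//= ler_pdivrMr// mul1r ler_nat -ltnS.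
(* The difference [k / n], which lies between [0] and [1], between
   [(n + 1) * (k / n)] and [k] accounts for the passage from [n] to [n + 1]
   points in both tails. *)
have kE (k : 'I_n.+1) : n.+1%:R * (k%:R / n%:R) = k%:R + k%:R / n%:R :> R.
  by rewrite -natr1 mulrDl mul1r mulrC divfK// gt_eqF.
have PU k : (P (U k) <= q%:E)%E.
  have /andP[k0 k1] := kn1 k.
  apply: (order_statistic_upper_tail (fun i w => V01 n i w n_gt0)
    (V_unif n ^~ n_gt0) (V_indep n n_gt0)) => //; first by lra.
    exact: ltW.
  by rewrite mulrDr kE; lra.
have PL k : (P (L k) <= q%:E)%E.
  have /andP[k0 k1] := kn1 k.
  apply: (order_statistic_lower_tail (fun i w => V01 n i w n_gt0)
    (V_unif n ^~ n_gt0) (V_indep n n_gt0)) => //; first by lra.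
    exact: ltW.
  by rewrite mulrBr kE -[k.+1%:R]natr1; lra.
have ESub : E `<=` \big[setU/set0]_(k < n.+1) (U k `|` L k).
  move=> w Ew; apply: contrapT => nUL; apply: sub Ew => [x x01|].
    apply: (@bernstein_node_error _ (f ^~ w) delta kappa delta0 (osc w) n
      (fun k => Y n k w) x n_gt0 _ x01) => [|k kn].
      by rewrite -mulrA delta2; lra.
    split; first exact: Y01.
    rewrite leNgt; apply/negP => dk; apply: nUL.
    rewrite -ltnS in kn.
    rewrite -(bigcup_pred xpredT); exists (Ordinal kn) => //.
    rewrite /U /L/=; move: dk; rewrite ltr_normr => /orP[]; [left|right]; lra.
  suff : expR (- (2 * n%:R * delta ^+ 2)) <= expR (- 4) by lra.
  by rewrite ler_expR -mulrA delta2; lra.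
have mUL k : measurable (U k `|` L k) by exact: measurableU.
have : (P E <= (\sum_(k < n.+1) (2 * q))%:E)%E.
  rewrite (@le_trans _ _ (P (\big[setU/set0]_(k < n.+1) (U k `|` L k))))//.
    by rewrite le_measure ?inE//; exact: bigsetU_measurable.
  rewrite (le_trans (probability_bigsetU_le P _ _))// -sumEFin lee_sum// => k _.
  by rewrite (le_trans (measureU2 _ _ _))// mulr_natl mulr2n EFinD; exact: leeD (PU k) (PL k).
rewrite -PEf lee_fin => /le_trans; apply.
rewrite sumr_const card_ord -[leLHS]mulr_natl -[leRHS]mulrA. rewrite ler_wpM2l//.
apply: le_trans (two_tails_le r01 tau1).
rewrite ler_pM2l// /q ler_expR lerN2 -mulrA ler_pM2l// -natr1 mulrDl delta2.
by rewrite mul1r lerDl sqr_ge0.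
Qed.
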